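(* Let $m\ge 0$ be an integer and let $\Pi^m$ be a High Order Universal Barrier Function for the system $\dot{\boldsymbol{x}}=F(\boldsymbol{x},\boldsymbol{u})$, with associated functions $\Pi^0,\dots,\Pi^m$ and class $\mathcal{K}_\infty$ functions $\alpha^0,\dots,\alpha^m$. Let $$\mathcal{A}_{\Pi^m}=\bigcap_{i=0}^m\{(\boldsymbol{x},\boldsymbol{u})\in\mathbb{R}^n\times\mathbb{R}^{n_u}:\Pi^i(\boldsymbol{x},\boldsymbol{u})\ge 0\}.$$ If $(\boldsymbol{x}_0,\boldsymbol{u}_0)\in\mathcal{A}_{\Pi^m}$, then any Lipschitz continuous controller $\boldsymbol{u}\in K_{\mathrm{HO\text{-}UBF}}$, i.e. any Lipschitz continuous controller for which $\dot\Pi^m(\boldsymbol{x},\boldsymbol{u})\ge-\alpha^m(\Pi^m(\boldsymbol{x},\boldsymbol{u}))$ holds along the closed-loop solution with $(\boldsymbol{x}(0),\boldsymbol{u}(0))=(\boldsymbol{x}_0,\boldsymbol{u}_0)$, ensures that $(\boldsymbol{x}(t),\boldsymbol{u}(t))\in\mathcal{A}_{\Pi^m}$ for all $t\ge 0$.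
   Context: System: $\dot{\boldsymbol{x}}=F(\boldsymbol{x},\boldsymbol{u})$, with $F:\mathbb{R}^n\times\mathbb{R}^{n_u}\to\mathbb{R}^n$ continuously differentiable ($n_u$ is the input dimension); the input is generated by an integral controller $\dot{\boldsymbol{u}}=\boldsymbol{\tau}(\boldsymbol{x},\boldsymbol{u})+\boldsymbol{v}(\boldsymbol{x},\boldsymbol{u})$ with $\boldsymbol{\tau}$ a given nominal integral control law. Dots denote time derivatives along closed-loop solutions. Class $\mathcal{K}_\infty$: continuous, strictly increasing, zero at zero, unbounded. In conditions where the argument may be negative, such functions are extended to strictly increasing continuous functions on $\mathbb{R}$. Constraints: $h_1,\dots,h_N$, $N=N_x+N_u$, where $h_1,\dots,h_{N_x}$ are functions of $\boldsymbol{x}$ and $h_{N_x+1},\dots,h_N$ are continuously differentiable functions of $\boldsymbol{u}$. The constraint sets $\{h_i\ge0\}$ are listed in order, and the set operation written after the $j$-th set is a union if $j\in\mathcal{P}$ and an intersection if $j\in\mathcal{Q}$, where $\mathcal{P},\mathcal{Q}$ partition $\{1,\dots,N-1\}$. For each state constraint $i\le N_x$, $h_i$ has relative degree $m_i\ge1$ and is $m_i$ times continuously differentiable; define $\Phi_i^1=h_i$, and for $2\le j\le m_i$, $\Phi_i^j=\dot\psi_i^{j-1}+\alpha_i(\psi_i^{j-1})$, where $\alpha_i$ is of class $\mathcal{K}_\infty$ and the functions $\psi_i^j$ are chosen with $\psi_i^j(\boldsymbol{x})\ge\Phi_i^j(\boldsymbol{x})$. Let $V$ be a control Lyapunov function: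 a continuously differentiable, positive definite $V:\mathbb{R}^n\to[0,\infty)$, proper on an open set $\mathcal{D}\ni 0$, with a positive definite $P$ such that for each $\boldsymbol{x}\in\mathcal{D}\setminus\{0\}$ some $\boldsymbol{u}$ satisfies $\nabla V(\boldsymbol{x})^{\mathrm T}F(\boldsymbol{x},\boldsymbol{u})\le -P(\boldsymbol{x})$. Put $h_V(\boldsymbol{x},\boldsymbol{u})=-\nabla V(\boldsymbol{x})^{\mathrm T}F(\boldsymbol{x},\boldsymbol{u})-P(\boldsymbol{x})$. Construction of $h^o$: put $g_i=\Phi_i^{m_i}$ for $i\le N_x$ and $g_i=h_i$ for $i>N_x$. Fix $\beta>0$ and set $H_1=\mathrm{e}^{\beta g_1}$; for $1\le j\le N-1$, $H_{j+1}=H_j+\mathrm{e}^{\beta g_{j+1}}$ if $j\in\mathcal{P}$ and $H_{j+1}=(H_j^{-1}+\mathrm{e}^{-\beta g_{j+1}})^{-1}$ if $j\in\mathcal{Q}$; finally $H_{N+1}=(H_N^{-1}+\mathrm{e}^{-\beta h_V})^{-1}$. Let $b_N$ be the reciprocal of the product of the lengths of the maximal runs of consecutive integers in $\mathcal{P}$ (empty product $=1$), and set $h^o=\frac1\beta\ln H_{N+1}+\frac1\beta\ln b_N$. High Order UBF: put $\Pi^0=h^o$. (First scenario, $m=0$.) Let $p^{h^o}=\frac{\partial h^o}{\partial\boldsymbol{u}}$ and $q^{h^o}=\frac{\partial h^o}{\partial\boldsymbol{x}}F+\frac{\partial h^o}{\partial\boldsymbol{u}}\boldsymbol{\tau}+\alpha(h^o)$.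 If $p^{h^o}(\boldsymbol{x},\boldsymbol{u})=0$ if and only if $q^{h^o}(\boldsymbol{x},\boldsymbol{u})\ge0$, then $\Pi^0=h^o$ is a High Order UBF if there is a class $\mathcal{K}_\infty$ function $\alpha$ (denoted $\alpha^0$) such that $\dot h^o\ge-\alpha(h^o)$. (Second scenario.) Otherwise, let $\Pi^i=\dot\Pi^{i-1}+\alpha^{i-1}(\Pi^{i-1})$ for $1\le i\le m$, with $\alpha^0,\dots,\alpha^{m-1}$ of class $\mathcal{K}_\infty$, and let $p^{\Pi^m}=\frac{\partial\Pi^m}{\partial\boldsymbol{u}}$, $q^{\Pi^m}=\frac{\partial\Pi^m}{\partial\boldsymbol{x}}F+\frac{\partial\Pi^m}{\partial\boldsymbol{u}}\boldsymbol{\tau}$. If $p^{\Pi^m}(\boldsymbol{x},\boldsymbol{u})=0$ if and only if $q^{\Pi^m}(\boldsymbol{x},\boldsymbol{u})\ge0$, then $\Pi^m$ is a High Order UBF if there is a class $\mathcal{K}_\infty$ function $\alpha$ (denoted $\alpha^m$) such that $\dot\Pi^m\ge-\alpha(\Pi^m)$. $K_{\mathrm{HO\text{-}UBF}}=\{\boldsymbol{u}\in\mathbb{R}^{n_u}:\dot\Pi^m(\boldsymbol{x},\boldsymbol{u})\ge-\alpha^m(\Pi^m(\boldsymbol{x},\boldsymbol{u}))\}$. All functions involved are assumed differentiable as often as needed for these expressions to make sense. *)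

(* Defs.v *)
From HB Require Import structures.
From mathcomp Require Import all_boot all_order all_algebra.
From mathcomp Require Import all_classical all_reals all_analysis.

Set Implicit Arguments.
Unset Strict Implicit.
Unset Printing Implicit Defensive.

Import Order.TTheory GRing.Theory Num.Theory.
Import numFieldNormedType.Exports.

Local Open Scope classical_set_scope.
Local Open Scope ring_scope.

(* On finite-dimensional V and W this is the usual class C^k. *)
Fixpoint Ck (R : realType) (V W : normedModType R) (k : nat) (f : V -> W)
    : Prop :=
  if k is k'.+1 then
    (forall a, differentiable f a) /\ (forall d, Ck k' (fun a => 'D_d f a))
  else continuous f.

(* Class K_infty functions, extended to strictly increasing continuous
   functions on the whole line because they get applied to values of either
   sign. *)
Definition Kinfty (R : realType) (a : R -> R) : Prop :=
  [/\ continuous a, {homo a : s t / s < t}, a 0 = 0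
    & a s @[s --> +oo%R] --> +oo%R].

Definition posdef (R : realType) (n : nat) (W : 'rV[R]_n -> R) : Prop :=
  W 0 = 0 /\ forall x, x != 0 -> 0 < W x.

Definition inner (R : realType) (n : nat) (a b : 'rV[R]_n) : R :=
  (a *m b^T) 0 0.

Definition grad (R : realType) (n : nat) (f : 'rV[R]_n -> R) (x : 'rV[R]_n)
    : 'rV[R]_n :=
  \row_i 'D_(delta_mx 0 i) f x.

Section PartialGradients.
Context {R : realType} {n nu : nat}.
Notation XU := ('rV[R]_n * 'rV[R]_nu)%type.

Definition grad_x (h : XU -> R) (z : XU) : 'rV[R]_n :=
  grad (fun x => h (x, z.2)) z.1.

Definition grad_u (h : XU -> R) (z : XU) : 'rV[R]_nu :=
  grad (fun u => h (z.1, u)) z.2.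

(* Time derivative of h at z along x' = F(x,u), u' = w. *)
Definition dot (F : XU -> 'rV[R]_n) (h : XU -> R) (w : 'rV[R]_nu) (z : XU)
    : R :=
  inner (grad_x h z) (F z) + inner (grad_u h z) w.

(* The number of times h must be differentiated along x' = F(x,u) before u
   appears explicitly: L k is the k-th derivative of h for k < r, a function
   of x alone, whereas the r-th derivative does depend on u. *)
Definition relative_degree (F : XU -> 'rV[R]_n) (h : 'rV[R]_n -> R) (r : nat)
    : Prop :=
  (0 < r)%N /\
  exists L : nat -> 'rV[R]_n -> R,
    [/\ forall x, L 0%N x = h x,
        forall k, (k < r)%N -> forall x, differentiable (L k) x,
        forall k, (k.+1 < r)%N -> forall x u,
          L k.+1 x = inner (grad (L k) x) (F (x, u))
      & exists x u u',
          inner (grad (L r.-1) x) (F (x, u)) !=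
          inner (grad (L r.-1) x) (F (x, u'))].

End PartialGradients.

(* Constraints are numbered from 1: h_i is [hx i] for 1 <= i <= Nx and [hu i]
   for Nx < i <= Nx + Nu; values of the families at other indices are
   irrelevant.  The operation after the j-th set is a union if [uni j] and an
   intersection otherwise, for 1 <= j < Nx + Nu. *)
Record ubf_data (R : realType) (n nu : nat) := UBFData {
  Nx : nat;
  Nu : nat;
  hx : nat -> 'rV[R]_n -> R;
  hu : nat -> 'rV[R]_nu -> R;
  uni : pred nat;
  rdeg : nat -> nat;
  alphah : nat -> R -> R;
  psi : nat -> nat -> 'rV[R]_n -> R;
  lyap : 'rV[R]_n -> R;
  lyapP : 'rV[R]_n -> R;
  lyapD : set 'rV[R]_n;
  beta : R
}.

Definition is_CLF (R : realType) (n nu : nat)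
    (F : 'rV[R]_n * 'rV[R]_nu -> 'rV[R]_n)
    (V P : 'rV[R]_n -> R) (D : set 'rV[R]_n) : Prop :=
  [/\ Ck 1 V /\ posdef V, posdef P,
      open D /\ D 0,
      (* the restriction of V to D is a proper map *)
      forall C : set R, compact C -> compact (D `&` V @^-1` C)
    & forall x, D x -> x != 0 ->
        exists u, inner (grad V x) (F (x, u)) <= - P x].

Section Construction.
Context {R : realType} {n nu : nat}.
Notation XU := ('rV[R]_n * 'rV[R]_nu)%type.
Variables (F : XU -> 'rV[R]_n) (S : ubf_data R n nu).

Definition Ncons : nat := (Nx S + Nu S)%N.

Definition Phi (i j : nat) (z : XU) : R :=
  if (j <= 1)%N then hx S i z.1
  else inner (grad (psi S i j.-1) z.1) (F z) + alphah S i (psi S i j.-1 z.1).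

Definition hV (z : XU) : R :=
  - inner (grad (lyap S) z.1) (F z) - lyapP S z.1.

Definition gcons (i : nat) (z : XU) : R :=
  if (i <= Nx S)%N then Phi i (rdeg S i) z else hu S i z.2.

(* [Hrec j] is H_j for j >= 1; the value at 0 is never used. *)
Fixpoint Hrec (j : nat) (z : XU) : R :=
  if j is k.+1 then
    if k == 0%N then expR (beta S * gcons 1 z)
    else if uni S k then Hrec k z + expR (beta S * gcons j z)
    else ((Hrec k z)^-1 + expR (- (beta S * gcons j z)))^-1
  else 0.

Definition Hfin (z : XU) : R :=
  ((Hrec Ncons z)^-1 + expR (- (beta S * hV z)))^-1.

(* {a, ..., b} is a maximal run of consecutive union indices, for 1 <= a. *)
Definition max_run (a b : nat) : bool :=
  [&& (a <= b)%N, all (uni S) (index_iota a b.+1), ~~ uni S a.-1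
    & ~~ uni S b.+1].

Definition bN : R :=
  (\prod_(1 <= a < Ncons) \prod_(1 <= b < Ncons | max_run a b)
     (b - a).+1%:R)^-1.

Definition ho (z : XU) : R :=
  (beta S)^-1 * ln (Hfin z) + (beta S)^-1 * ln bN.

Definition admissible_data : Prop :=
  [/\ [/\ Ck 1 F, (0 < Ncons)%N, 0 < beta S
        & forall j, uni S j -> (1 <= j < Ncons)%N],
      forall i, (1 <= i <= Nx S)%N ->
        [/\ relative_degree F (hx S i) (rdeg S i),
            Ck (rdeg S i) (hx S i),
            Kinfty (alphah S i),
            forall j, (1 <= j < rdeg S i)%N ->
              forall x, differentiable (psi S i j) x
          & forall j, (1 <= j < rdeg S i)%N ->
              forall x u, Phi i j (x, u) <= psi S i j x],
      forall i, (Nx S < i <= Ncons)%N -> Ck 1 (hu S i)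
    & is_CLF F (lyap S) (lyapP S) (lyapD S)].

End Construction.

Section HOUBF.
Context {R : realType} {n nu : nat}.
Notation XU := ('rV[R]_n * 'rV[R]_nu)%type.
Variables (F : XU -> 'rV[R]_n) (tau v : XU -> 'rV[R]_nu).
Variables (alpha : nat -> R -> R) (Pi : nat -> XU -> R).

(* Time derivative along x' = F(x,u), u' = tau(x,u) + v(x,u). *)
Definition cldot (h : XU -> R) (z : XU) : R := dot F h (tau z + v z) z.

Definition first_scenario : Prop :=
  forall z, grad_u (Pi 0%N) z = 0 <->
    0 <= dot F (Pi 0%N) (tau z) z + alpha 0%N (Pi 0%N z).

Definition top_scenario (m : nat) : Prop :=
  forall z, grad_u (Pi m) z = 0 <-> 0 <= dot F (Pi m) (tau z) z.

(* The last clause of the definition asks that the inequality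
   (d/dt) Pi^m >= - alpha^m (Pi^m) can be achieved at every point by some
   value w of the correction term; that a particular v achieves it is the
   separate condition [K_HOUBF]. *)
Definition is_HOUBF (S : ubf_data R n nu) (m : nat) : Prop :=
  [/\ forall z, Pi 0%N z = ho F S z,
      forall i, (i <= m)%N ->
        Kinfty (alpha i) /\ forall z, differentiable (Pi i) z,
      forall i, (i < m)%N -> forall z,
        Pi i.+1 z = cldot (Pi i) z + alpha i (Pi i z),
      (if m == 0%N then first_scenario
       else ~ first_scenario /\ top_scenario m)
    & forall z, exists w, - alpha m (Pi m z) <= dot F (Pi m) (tau z + w) z].

Definition K_HOUBF (m : nat) (x : 'rV[R]_n) : set 'rV[R]_nu :=
  [set u | - alpha m (Pi m (x, u)) <= cldot (Pi m) (x, u)].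

Definition safe_set (m : nat) : set XU :=
  \bigcap_(i < m.+1) [set z | 0 <= Pi i z].

(* Solution on [0, T[ with T possibly infinite; x and u are unconstrained
   outside that interval. *)
Definition closed_loop_solution (T : \bar R) (x : R -> 'rV[R]_n)
    (u : R -> 'rV[R]_nu) : Prop :=
  [/\ x @ 0^'+ --> x 0, u @ 0^'+ --> u 0
    & forall t : R, 0 < t -> (t%:E < T)%E ->
        is_derive t 1 x (F (x t, u t)) /\
        is_derive t 1 u (tau (x t, u t) + v (x t, u t))].

End HOUBF.

(* Main.v *)
(** Along a solution put y_i(t) = Pi^i(x(t), u(t)).  By the chain rule
    y_i' = Pi^{i+1} - alpha^i(y_i) for i < m and y_m' >= - alpha^m(y_m).  If
    y' >= - alpha(y) and y 0 >= 0, then y cannot become negative: after its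
    last nonnegative time y would be negative, hence increasing, since
    alpha < 0 on the negative reals.  So y_m >= 0, and each y_{i+1} >= 0 gives
    y_i' >= - alpha^i(y_i), hence y_i >= 0, by descending induction on i. *)
Require Import Defs.
From mathcomp Require Import all_boot all_order all_algebra.
From mathcomp Require Import all_classical all_reals all_analysis.
Import Order.TTheory GRing.Theory Num.Theory.
Import numFieldNormedType.Exports.
Local Open Scope classical_set_scope.
Local Open Scope ring_scope.

(** No Lipschitz bound on [a] is assumed, so [y] is not compared with a solution of y' = - a(y); the
    mean value theorem after the last nonnegative time replaces that comparison. *)
Lemma barrier_ge0 (R : realType) (a y y' : R -> R) (t : R) :
  {homo a : r s / r < s} -> a 0 = 0 ->
  y @ 0^'+ --> y 0 ->
  (forall s, 0 < s -> s <= t -> is_derive s 1 y (y' s)) ->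
  (forall s, 0 < s -> s <= t -> - a (y s) <= y' s) ->
  0 <= t -> 0 <= y 0 -> 0 <= y t.
Proof.
move=> a_incr a0 y_right dy ay' t_ge0 y0; rewrite leNgt; apply/negP => yt.
have cy s : 0 < s -> s <= t -> {for s, continuous y}.
  move=> s0 st; apply: differentiable_continuous.
  by apply/derivable1_diffP; have [] := dy s s0 st.
pose A := [set s | [/\ 0 <= s, s <= t & 0 <= y s]].
have A0 : A 0 by [].
have hA : has_sup A by split; [exists 0 | exists t => s []].
pose s := sup A.
have s_ge0 : 0 <= s by exact: sup_upper_bound.
have s_le : s <= t by apply: ge_sup; [exists 0 | move=> r []].
have ys : 0 <= y s.
  (* The supremum is attained: if [y s < 0] with [s > 0], then [y] is negative on a ball around [s],
     yet points of [A] come arbitrarily close to [s]. *)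
  move: s_ge0; rewrite le_eqVlt => /predU1P[<- //|s_gt0].
  rewrite leNgt; apply/negP => ys.
  have /nbhs_ballP[e /= e0 he] : \forall r \near s, y r < 0.
    exact: (cvgr_lt _ (cy s s_gt0 s_le)).
  have [r [r0 rt yr] sr] := sup_adherent e0 hA.
  have rs : r <= s by apply: sup_upper_bound.
  have /he : ball s e r.
    by rewrite /ball /= ger0_norm ?subr_ge0// ltrBlDr -ltrBlDl.
  by rewrite /= ltNge yr.
have st : s < t.
  by rewrite lt_neqAle s_le andbT; apply: contraTneq yt => <-; rewrite -leNgt.
have y_neg r : s < r -> r <= t -> y r < 0.
  move=> sr rt; rewrite ltNge; apply/negP => yr.
  have r0 : 0 <= r by rewrite (le_trans s_ge0)// ltW.
  by move: sr; rewrite ltNge => /negP; apply; apply: sup_upper_bound.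
have sy : {within `[s, t], continuous y}.
  apply/(continuous_within_itvP _ st); split.
  - move=> r; rewrite in_itv /= => /andP[sr rt].
    by apply: cy; [exact: le_lt_trans sr | exact: ltW].
  (* If [s = 0], no derivative is available there, and right continuity comes from [y_right]. *)
  - move: s_ge0; rewrite le_eqVlt => /predU1P[<- //|s_gt0].
    by apply: cvg_at_right_filter; exact: cy.
  - by apply: cvg_at_left_filter; apply: cy => //; exact: le_lt_trans st.
have dsy r : r \in `]s, t[ -> is_derive r 1 y (y' r).
  rewrite in_itv /= => /andP[sr rt].
  by apply: dy; [exact: le_lt_trans sr | exact: ltW].
have [c] := MVT st dsy sy.
rewrite in_itv /= => /andP[sc ct] yE.
have : 0 < y' c.
  apply: lt_le_trans (ay' c (le_lt_trans s_ge0 sc) (ltW ct)).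
  by rewrite oppr_gt0 -a0; apply: a_incr; exact: y_neg (ltW ct).
(* Since [y t < 0 <= y s], the mean slope [y' c] must be nonpositive. *)
apply/negP; rewrite -leNgt -(pmulr_lle0 _ (_ : 0 < t - s)) ?subr_gt0//.
by rewrite -yE subr_le0 (le_trans (ltW yt)).
Qed.

Lemma diff_grad (R : realType) (n : nat) (f : 'rV[R]_n -> R) (x w : 'rV[R]_n) :
  differentiable f x -> 'd f x w = inner (grad f x) w.
Proof.
move=> df; rewrite {1}(row_sum_delta w) linear_sum /inner mxE.
apply: eq_bigr => i _; rewrite linearZ !mxE deriveE//.
exact: mulrC.
Qed.

(** The partial gradients come from composing [h] with the two slice embeddings through [z], whose
    differentials are [a |-> (a, 0)] and [b |-> (0, b)]; linearity of ['d h z] adds the two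
    parts. *)
Lemma diff_grad_xu (R : realType) (n nu : nat) (h : 'rV[R]_n * 'rV[R]_nu -> R)
    (z w : 'rV[R]_n * 'rV[R]_nu) :
  differentiable h z ->
  'd h z w = inner (grad_x h z) w.1 + inner (grad_u h z) w.2.
Proof.
case: z w => x u [a b] dh /=; rewrite /grad_x /grad_u /=.
have dx : is_diff x (fun x' => (x', u)) (fun a' => (a', 0)).
  exact: is_diff_pair.
have du : is_diff u (fun u' => (x, u')) (fun b' => (0, b')).
  exact: is_diff_pair.
have hx := is_diff_comp dx (differentiableP dh).
have hu := is_diff_comp du (differentiableP dh).
rewrite -!diff_grad; [|by case: hu|by case: hx].
rewrite (@diff_val _ _ _ _ _ _ _ hx) (@diff_val _ _ _ _ _ _ _ hu) /= -linearD /=.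
by congr ('d h (x, u) (_, _)); rewrite ?addr0 ?add0r.
Qed.

(** Chain rule identifying the formal expression [dot] with a genuine time derivative along a
    curve. *)
Lemma is_derive_dot (R : realType) (n nu : nat)
    (F : 'rV[R]_n * 'rV[R]_nu -> 'rV[R]_n) (w : 'rV[R]_nu)
    (h : 'rV[R]_n * 'rV[R]_nu -> R) (x : R -> 'rV[R]_n) (u : R -> 'rV[R]_nu)
    (t : R) :
  differentiable h (x t, u t) ->
  is_derive t 1 x (F (x t, u t)) -> is_derive t 1 u w ->
  is_derive t 1 (fun s => h (x s, u s)) (dot F h w (x t, u t)).
Proof.
move=> dh [dx xE] [du uE].
have Dx : differentiable x t by exact/derivable1_diffP.
have Du : differentiable u t by exact/derivable1_diffP.
have Dxu : differentiable (fun s => (x s, u s)) t by exact: differentiable_pair.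
have Dh : differentiable (h \o (fun s => (x s, u s))) t.
  exact: differentiable_comp.
split; first exact/derivable1_diffP.
rewrite deriveE// diff_comp//= diff_pair//= -!deriveE// xE uE.
by rewrite deriveE// diff_grad_xu.
Qed.

Theorem theorem7 (R : realType) (n nu : nat)
  (F : 'rV[R]_n * 'rV[R]_nu -> 'rV[R]_n)
  (tau : 'rV[R]_n * 'rV[R]_nu -> 'rV[R]_nu)
  (S : ubf_data R n nu) (hS : admissible_data F S)
  (v : 'rV[R]_n * 'rV[R]_nu -> 'rV[R]_nu)
  (m : nat) (alpha : nat -> R -> R) (Pi : nat -> 'rV[R]_n * 'rV[R]_nu -> R)
  (hPi : is_HOUBF F tau v alpha Pi S m)
  (hLip : [locally [lipschitz tau z + v z | z in setT]])
  (x0 : 'rV[R]_n) (u0 : 'rV[R]_nu) (h0 : safe_set Pi m (x0, u0))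
  (T : \bar R) (x : R -> 'rV[R]_n) (u : R -> 'rV[R]_nu)
  (hsol : closed_loop_solution F tau v T x u)
  (hx0 : x 0 = x0) (hu0 : u 0 = u0)
  (hK : forall t : R, 0 <= t -> (t%:E < T)%E ->
     K_HOUBF F tau v alpha Pi m (x t) (u t)) :
  forall t : R, 0 <= t -> (t%:E < T)%E -> safe_set Pi m (x t, u t).
Proof.
move=> t t0 tT.
case: hPi => _ hreg hstep _ _; case: hsol => x_right u_right dxu.
have Pi_sol_ge0 i : (i <= m)%N ->
    (forall s : R, 0 < s -> (s%:E < T)%E ->
      - alpha i (Pi i (x s, u s)) <= cldot F tau v (Pi i) (x s, u s)) ->
    forall s : R, 0 <= s -> (s%:E < T)%E -> 0 <= Pi i (x s, u s).
  move=> im hi s s0 sT; have [[_ a_incr a0 _] dPi] := hreg i im.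
  have ltT r : r <= s -> (r%:E < T)%E.
    by move=> rs; apply: le_lt_trans sT; rewrite lee_fin.
  apply: (@barrier_ge0 _ (alpha i) (fun r => Pi i (x r, u r))
    (fun r => cldot F tau v (Pi i) (x r, u r)) s) => //.
  - apply: (@cvg_comp _ _ _ (fun r => (x r, u r)) (Pi i)).
      exact: cvg_pair x_right u_right.
    exact: (differentiable_continuous (dPi (x 0, u 0))).
  (* [cldot] is [dot] with [w] equal to the closed-loop input velocity [tau + v]. *)
  - move=> r r0 /ltT rT; have [dx du] := dxu r r0 rT.
    exact: is_derive_dot.
  - by move=> r r0 /ltT; exact: hi.
  - by rewrite hx0 hu0; apply: h0 => /=; rewrite ltnS.
(* The descent from level [m] is an induction on the distance [k] to the top; [hK] supplies the base
   case. *)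
have Pi_ge0 k : (k <= m)%N ->
    forall s : R, 0 <= s -> (s%:E < T)%E -> 0 <= Pi (m - k)%N (x s, u s).
  elim: k => [_|k IH km].
    by rewrite subn0; apply: Pi_sol_ge0 => // s s0; exact: hK (ltW s0).
  have mkE : (m - k = (m - k.+1).+1)%N by rewrite subnSK.
  apply: Pi_sol_ge0 => [|s s0 sT]; first exact: leq_subr.
  have := IH (ltnW km) s (ltW s0) sT.
  (* By the recursion for [Pi], nonnegativity one level up is exactly the barrier inequality at this
     level. *)
  by rewrite mkE hstep -?mkE ?leq_subr// -lerBlDr sub0r.
move=> i /=; rewrite ltnS => im.
by rewrite -(subKn im); apply: Pi_ge0 => //; exact: leq_subr.
Qed.
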